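(* Let $n\ge 3$ be an integer, and let $G=\mathbb{F}_2^{n-1}\rtimes_\varphi D_{2n}$ and $\rho_0,\rho_1,\rho_2\in G$ be as defined in the context. Then $(G,\{\rho_0,\rho_1,\rho_2\})$ is a string C-group of type $[n,n]$, corresponding to a regular $3$-polytope with Schläfli type $\{n,n\}$.
   Context: Let $U=(U_{ij})$ and $V=(V_{ij})$ be the $(n-1)\times(n-1)$ matrices over $\mathbb{F}_2$ given by: for $1\le i\le n-2$, $U_{ij}=1$ if $i+j=n-1$ and $U_{ij}=0$ otherwise, and $U_{n-1,j}=1$ for all $j$; $V_{ij}=1$ if $i+j=n$ and $V_{ij}=0$ otherwise. Let $D_{2n}=\langle h_0,h_1\mid (h_0h_1)^n=h_0^2=h_1^2=e\rangle$ be the dihedral group of order $2n$, and let $\varphi:D_{2n}\to\mathrm{Aut}(\mathbb{F}_2^{n-1})\cong\mathrm{GL}(n-1,\mathbb{F}_2)$ be the faithful representation with $\varphi(h_0)=U$ and $\varphi(h_1)=V$. Elements of $\mathbb{F}_2^{n-1}$ are written as column vectors. The semidirect product $G=\mathbb{F}_2^{n-1}\rtimes_\varphi D_{2n}$ has group operation $(\mathbf{a},x)\cdot(\mathbf{b},y)=(\mathbf{a}+\varphi(x)^{-1}\mathbf{b},\,xy)$ for all $\mathbf{a},\mathbf{b}\in\mathbb{F}_2^{n-1}$ and $x,y\in D_{2n}$. Put $\rho_0=(\mathbf{0},h_0)$, $\rho_1=(\mathbf{0},h_1)$, $\rho_2=((0,\dots,0,1)^\top,h_0)$, where $\mathbf{0}$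 is the zero vector. A string group generated by involutions is a pair $(G,\{\rho_0,\ldots,\rho_{d-1}\})$, where $G$ is a finite group generated by involutions $\rho_i$ such that $(\rho_i\rho_j)^2=1$ for $|i-j|>1$ and $(\rho_{i-1}\rho_i)^{p_i}=1$ for some $p_i\ge 2$. It is a string C-group (of rank $d$) if in addition $\langle\rho_i\mid i\in I\rangle\cap\langle\rho_j\mid j\in J\rangle=\langle\rho_k\mid k\in I\cap J\rangle$ for all $I,J\subseteq\{0,\ldots,d-1\}$. Its type is $[p_1,\ldots,p_{d-1}]$, where $p_i$ is the order of $\rho_{i-1}\rho_i$. An abstract polytope of rank $d$ (a $d$-polytope) is a partially ordered set $\mathcal{P}$ with a rank function $\mathrm{rank}:\mathcal{P}\to\{-1,0,\ldots,d\}$ such that: (i) $\mathcal{P}$ contains a unique minimal element $F_{-1}$ and a unique maximal element $F_d$; (ii) every maximal totally ordered subset (flag) contains exactly $d+2$ elements, including $F_{-1}$ and $F_d$; (iii) for any $F<G$ in $\mathcal{P}$ with $\mathrm{rank}(G)-\mathrm{rank}(F)=2$, there are exactly two elements $H_1,H_2$ with $F<H_i<G$; (iv) any two flags $\Phi,\Psi$ can be connected by a sequence of flags $\Phi=\Phi_0,\Phi_1,\ldots,\Phi_k=\Psi$ in which consecutive flags differ by exactly one element. Elements of rank $i$ are called $i$-faces. An automorphism is an order-preserving bijection of $\mathcal{P}$ onto itself mapping $i$-faces to $i$-faces; $\mathcal{P}$ is regular if its automorphism group $\mathrm{Aut}(\mathcal{P})$ acts transitively on the flags. Regular $d$-polytopes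 and string C-groups of rank $d$ are in one-to-one correspondence. Given a regular $d$-polytope $\mathcal{P}$ with base flag $\Phi$, the associated string C-group is $\mathrm{Aut}(\mathcal{P})$ with generators $\rho_0,\ldots,\rho_{d-1}$, where $\rho_i$ maps $\Phi$ to the unique flag differing from $\Phi$ at the $i$-face. Conversely, given a string C-group $(G,\{\rho_0,\ldots,\rho_{d-1}\})$, the $i$-faces ($0\le i\le d-1$) of the corresponding polytope are the right cosets of $\langle\rho_j\mid j\ne i\rangle$, incidence being non-empty intersection, together with a minimal and a maximal element; its automorphism group is isomorphic to $G$. The Schläfli type of the polytope is $\{p_1,\ldots,p_{d-1}\}$, with $p_i$ the order of $\rho_{i-1}\rho_i$. *)

(* Defs.v *)
From HB Require Import structures.
From mathcomp Require Import all_boot all_order all_algebra all_fingroup.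

Set Implicit Arguments.
Unset Strict Implicit.
Unset Printing Implicit Defensive.

Import GRing.Theory.

Local Open Scope group_scope.

Definition gen_by (gT : finGroupType) (d : nat) (rho : d.-tuple gT)
    (I : {set 'I_d}) : {group gT} :=
  <<[set tnth rho i | i in I]>>%G.

Definition string_group (gT : finGroupType) (d : nat)
    (G : {group gT}) (rho : d.-tuple gT) : Prop :=
  [/\ gen_by rho [set: 'I_d] = G,
      forall i : 'I_d, #[tnth rho i] = 2,
      forall i j : 'I_d, (i.+1 < j)%N || (j.+1 < i)%N ->
        (tnth rho i * tnth rho j) ^+ 2 = 1
    & forall i j : 'I_d, j = i.+1 :> nat ->
        exists2 p : nat, (2 <= p)%N & (tnth rho i * tnth rho j) ^+ p = 1].

Definition string_C_group (gT : finGroupType) (d : nat)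
    (G : {group gT}) (rho : d.-tuple gT) : Prop :=
  string_group G rho /\
  forall I J : {set 'I_d},
    gen_by rho I :&: gen_by rho J = gen_by rho (I :&: J) :> {set gT}.

Definition string_type (gT : finGroupType) (d : nat) (rho : d.-tuple gT) :
    seq nat :=
  [seq #[nth 1 rho i.-1 * nth 1 rho i] | i <- iota 1 d.-1].

(* The order is an explicit relation, not an instance of porderType, because  *)
(* incidence of cosets (coset_le below) is only transitive for string groups. *)
(* String groups are finite, so only finite posets are needed.                *)
Section Polytope.

Variables (P : finType) (le : rel P) (rk : P -> int) (d : nat).

Let lt (x y : P) : bool := (x != y) && le x y.

Definition chain (A : {set P}) : bool :=
  [forall x in A, forall y in A, le x y || le y x].

Definition flag (A : {set P}) : bool := maxset chain A.

Definition flag_adjacent (A B : {set P}) : bool :=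
  [&& flag A, flag B, #|A :\: B| == 1%N & #|B :\: A| == 1%N].

Definition polytope : Prop :=
  [/\ [/\ reflexive le, antisymmetric le & transitive le],
      (forall x, (-1 <= rk x <= d%:Z)%R) /\
      (forall x y, lt x y -> (rk x < rk y)%R),
      exists Fmin Fmax : P,
        [/\ unique (fun x => forall y, ~~ lt y x) Fmin,
            unique (fun x => forall y, ~~ lt x y) Fmax
          & forall A, flag A -> [/\ #|A| = d.+2, Fmin \in A & Fmax \in A]],
      forall x y, lt x y -> (rk y - rk x = 2)%R ->
        #|[set z | lt x z && lt z y]| = 2
    & forall A B, flag A -> flag B -> connect flag_adjacent A B].

Definition polytope_aut : {set {perm P}} :=
  [set f : {perm P} | [forall x, forall y, le x y ==> le (f x) (f y)]
                      && [forall x, rk (f x) == rk x]].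

Definition regular_polytope : Prop :=
  polytope /\
  [transitive polytope_aut, on [set A : {set P} | flag A] | 'P^*].

(* f is the automorphism mapping the flag A to the flag that differs from A   *)
(* exactly at its face of rank i.                                             *)
Definition distinguished_aut (A : {set P}) (i : nat) (f : {perm P}) : Prop :=
  [/\ f \in polytope_aut, flag (f @: A), f @: A != A
    & [set x in f @: A | rk x != Posz i] = [set x in A | rk x != Posz i]].

Definition distinguished_generators (A : {set P}) (r : d.-tuple {perm P}) :
    Prop :=
  forall i : 'I_d, distinguished_aut A i (tnth r i).

(* The type does not depend on the base flag of a regular polytope.           *)
Definition schlafli_type (p : seq nat) : Prop :=
  forall A : {set P}, flag A ->
    exists2 r : d.-tuple {perm P},
      distinguished_generators A r & string_type r = p.

(* Permutations compose from left to right, so the automorphism group acts    *)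
(* on the right, as needed by its action on right cosets.                     *)
Definition corresponds_to (gT : finGroupType) (G : {group gT})
    (rho : d.-tuple gT) : Prop :=
  exists (A : {set P}) (f : {morphism G >-> {perm P}}),
    [/\ flag A, isom G polytope_aut f
      & distinguished_generators A (map_tuple f rho)].

End Polytope.

Section CosetPoset.

Variables (gT : finGroupType) (d : nat) (G : {group gT}) (rho : d.-tuple gT).

(* inl false and inl true are the adjoined least and greatest elements F_(-1) *)
(* and F_d; the other elements are the pairs (i, right coset) with i < d,     *)
(* tagged by i as cosets of distinct subgroups could coincide as sets.        *)
Definition coset_face : finType :=
  (bool + {x : 'I_d * {set gT} | x.2 \in rcosets (gen_by rho [set~ x.1]) G})%type.

Definition coset_rank (x : coset_face) : int :=
  match x with
  | inl false => (-1)%R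
  | inl true => Posz d
  | inr u => Posz (val u).1
  end.

Definition coset_le : rel coset_face := fun x y =>
  match x, y with
  | inl false, _ => true
  | _, inl true => true
  | inr u, inr v =>
      ((val u).1 <= (val v).1)%N && ((val u).2 :&: (val v).2 != set0)
  | _, _ => false
  end.

End CosetPoset.

(* Aut (F_2^m): additive bijections, which compose from left to right, so     *)
(* that phi (x * y) below is phi x followed by phi y.                         *)
Notation autF2 m := (subg_of [Aut [set: 'cV['F_2]_m]]%G).

Record semidirect (m : nat) (D : finGroupType)
    (phi : {morphism [set: D] >-> autF2 m}) :
    predArgType :=
  SDPair { sd_vec : 'cV['F_2]_m; sd_elt : D }.

Section SemidirectProduct.

Variables (m : nat) (D : finGroupType).
Local Notation V := 'cV['F_2]_m.
Variable phi : {morphism [set: D] >-> autF2 m}.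

Definition sd_pair (u : semidirect phi) : V * D := (sd_vec u, sd_elt u).
Definition pair_sd (p : V * D) : semidirect phi := SDPair phi p.1 p.2.
Lemma sd_pairK : cancel sd_pair pair_sd. Proof. by case. Qed.

HB.instance Definition _ := Finite.copy (semidirect phi) (can_type sd_pairK).

Definition sd_mul (u v : semidirect phi) : semidirect phi :=
  SDPair phi (sd_vec u + sgval (phi (sd_elt u))^-1 (sd_vec v))%R
             (sd_elt u * sd_elt v).

Definition sd_one : semidirect phi := SDPair phi 0%R 1.

Definition sd_inv (u : semidirect phi) : semidirect phi :=
  SDPair phi (- sgval (phi (sd_elt u)) (sd_vec u))%R (sd_elt u)^-1.

Lemma sd_actD (x : D) (a b : V) :
  (sgval (phi x) (a + b) = sgval (phi x) a + sgval (phi x) b)%R.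
Proof.
have /Aut_morphic/morphicP fM := subgP (phi x).
exact: (fM a b (in_setT a) (in_setT b)).
Qed.

Lemma sd_actM (x y : D) (a : V) :
  sgval (phi (x * y))^-1 a = sgval (phi x)^-1 (sgval (phi y)^-1 a).
Proof. by rewrite morphM ?inE //= invMg permM. Qed.

Lemma sd_mulA : associative sd_mul.
Proof.
move=> u v w; rewrite /sd_mul /= mulgA; congr (SDPair phi _ _).
have VE x : (sgval (phi x))^-1 = sgval (phi x^-1) by rewrite morphV ?inE.
by rewrite sd_actM /= VE sd_actD addrA.
Qed.

Lemma sd_mul1 : left_id sd_one sd_mul.
Proof.
case=> a x; rewrite /sd_mul /= mul1g; congr (SDPair phi _ _).
by rewrite morph1 /= invg1 perm1 add0r.
Qed.

Lemma sd_mulV : left_inverse sd_one sd_inv sd_mul.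
Proof.
case=> a x; rewrite /sd_mul /sd_inv /= mulVg; congr (SDPair phi _ _).
by rewrite morphV ?inE //= invgK addNr.
Qed.

HB.instance Definition _ :=
  Finite_isGroup.Build (semidirect phi) sd_mulA sd_mul1 sd_mulV.

End SemidirectProduct.

(* D = < h0, h1 | (h0 h1)^n = h0^2 = h1^2 = 1 >: given the isomorphism type   *)
(* of D, any generating pair that satisfies the relations is such a pair.     *)
Definition dihedral_presentation (n : nat) (D : finGroupType) (h0 h1 : D) :
    Prop :=
  [/\ [set: D] \isog Grp (x : y : (x * y) ^+ n, x ^+ 2, y ^+ 2),
      <<[set h0; h1]>> = [set: D],
      (h0 * h1) ^+ n = 1, h0 ^+ 2 = 1 & h1 ^+ 2 = 1].

(* Row and column numbers are one more than the values of the ordinals i, j.  *)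
Definition matU (n : nat) : 'M['F_2]_n.-1 :=
  (\matrix_(i, j) ((i.+1 == n.-1) || (i.+1 + j.+1 == n.-1))%N%:R)%R.

Definition matV (n : nat) : 'M['F_2]_n.-1 :=
  (\matrix_(i, j) (i.+1 + j.+1 == n)%N%:R)%R.

Definition last_unit (n : nat) : 'cV['F_2]_n.-1 :=
  (\col_i (i.+1 == n.-1)%:R)%R.

Definition dihedral_rep (n : nat) (D : finGroupType) (h0 h1 : D)
    (phi : {morphism [set: D] >-> autF2 n.-1}) : Prop :=
  (forall a, sgval (phi h0) a = matU n *m a)%R /\
  (forall a, sgval (phi h1) a = matV n *m a)%R.

Definition rho_gens (n : nat) (D : finGroupType) (h0 h1 : D)
    (phi : {morphism [set: D] >-> autF2 n.-1}) :
    3.-tuple (semidirect phi) :=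
  [tuple SDPair phi 0%R h0; SDPair phi 0%R h1; SDPair phi (last_unit n) h0].

(* Main.v *)
Require Import Defs.
From mathcomp Require Import all_boot all_order all_algebra all_fingroup.
From mathcomp Require Import cyclic zify.

(** The argument has a part about this group and a part about all string
    C-groups.

    Identify F_2^(n-1) with the even weight vectors of the permutation module
    F_2^(Z/n), where the k-th unit vector becomes x_0 + x_k; call it
    [vertex k], with [vertex 0] = [vertex n] = 0.  The matrices U and V then
    permute the vertices x_k of an n-gon, as the reflections k |-> -1 - k and
    k |-> -k ([matU_vertex], [matV_vertex]), and h0 h1 acts as the rotation
    k |-> k + 1 ([rot_vertex]); hence h0 h1 has order n.  The vector of rho_2 is
    x_0 + x_(-1), so that in the larger group F_2^(Z/n) >| D conjugation by x_0
    fixes rho_1 and maps rho_0 to rho_2: the subgroup < rho_1, rho_2 > is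
    another copy of D, in which x lies over the vector x_0 + x^-1 x_0.
    Concretely, (rho_1 rho_2)^k has the vector [vertex k] ([rho12_pow]).  Thus
    the element over x is in D = < rho_0, rho_1 > only if x fixes the vertex 0,
    which gives < rho_0, rho_1 > :&: < rho_1, rho_2 > = < rho_1 >.  In rank
    three, all the other cases of the intersection property follow from this
    one ([string_C_group_rank3]).

    For a string C-group of any rank, the polytope is recovered from the
    cosets by one factorisation: the subgroup generated by all rho_i except
    rho_j is the product of the commuting subgroups generated by those below
    and by those above j ([gen_by_setC1_split]).  It allows flags through a
    common j-face to be cut and glued at that face ([splice]), which makes
    incidence transitive and shows that each chain has a common element g,
    i.e., lies in the set [flag_at g] of the cosets of g ([chain_sub_flag]).  So
    the flags are exactly the sets [flag_at g], the generators move from a flag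
    to its neighbours, and the group acts on the flags simply transitively. *)

Set Implicit Arguments.
Unset Strict Implicit.
Unset Printing Implicit Defensive.

Import Order.POrderTheory Order.TotalTheory.

Local Open Scope group_scope.

(** * Subgroups generated by some of the generators *)

Section StringGroup.

Variables (gT : finGroupType) (d : nat) (G : {group gT}) (rho : d.-tuple gT).

Lemma gen_byS (I J : {set 'I_d}) :
  I \subset J -> gen_by rho I \subset gen_by rho J.
Proof. by move=> sIJ; apply/genS/imsetS. Qed.

Lemma mem_gen_by (I : {set 'I_d}) i : i \in I -> tnth rho i \in gen_by rho I.
Proof. by move=> Ii; apply/mem_gen/imset_f. Qed.

Lemma gen_by1 i : gen_by rho [set i] = <[tnth rho i]>%G.
Proof. by apply: val_inj; rewrite /= imset_set1. Qed.

Lemma gen_by0 : gen_by rho set0 = 1%G.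
Proof. by apply: val_inj; rewrite /= imset0 gen0. Qed.

Hypothesis stringG : string_group G rho.

Lemma gen_by_setT : gen_by rho [set: 'I_d] = G.
Proof. by case: stringG. Qed.

Lemma gen_by_sub I : gen_by rho I \subset G.
Proof. by rewrite -gen_by_setT gen_byS ?subsetT. Qed.

Lemma mem_gen_by_sub I x : x \in gen_by rho I -> x \in G.
Proof. exact/subsetP/gen_by_sub. Qed.

Lemma tnth_rho_in i : tnth rho i \in G.
Proof. by apply/(@mem_gen_by_sub setT)/mem_gen_by; rewrite inE. Qed.

Lemma order_rho i : #[tnth rho i] = 2.
Proof. by case: stringG. Qed.

Lemma rho_neq1 i : tnth rho i != 1.
Proof. by rewrite -order_gt1 order_rho. Qed.

Lemma rhoV i : (tnth rho i)^-1 = tnth rho i.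
Proof. by apply: invg2id; apply: order_rho. Qed.

Lemma rho_far_commute (i j : 'I_d) :
  (i.+1 < j)%N || (j.+1 < i)%N -> commute (tnth rho i) (tnth rho j).
Proof.
case: stringG => _ _ far _ /far; rewrite expgS expg1 => /(canRL (mulgK _)).
by rewrite mul1g invMg !rhoV.
Qed.

(** Generators whose indices are not adjacent commute. *)
Lemma gen_byU_far (I J : {set 'I_d}) :
    {in I & J, forall i j : 'I_d, (i.+1 < j)%N || (j.+1 < i)%N} ->
  gen_by rho (I :|: J) = gen_by rho I * gen_by rho J :> {set gT}.
Proof.
move=> farIJ; rewrite -cent_joinEr; last first.
  rewrite /= gen_subG; apply/subsetP=> _ /imsetP[j Jj ->].
  rewrite /gen_by /= cent_gen; apply/centP=> _ /imsetP[i Ii ->].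
  exact/commute_sym/rho_far_commute/farIJ.
by rewrite /= joing_idl joing_idr imsetU.
Qed.

Lemma gen_by_setC1_split (j : 'I_d) x : x \in gen_by rho [set~ j] ->
  exists2 u, u \in gen_by rho [set i : 'I_d | (i < j)%N]
    & exists2 v, v \in gen_by rho [set i : 'I_d | (j < i)%N] & x = u * v.
Proof.
have -> : [set~ j] = [set i : 'I_d | (i < j)%N] :|: [set i : 'I_d | (j < i)%N].
  by apply/setP=> i; rewrite !inE -neq_ltn.
rewrite gen_byU_far => [/mulsgP[u v Hu Hv ->]|i k]; first by exists u => //; exists v.
by rewrite !inE => ltij ltjk; rewrite (leq_trans _ ltjk).
Qed.

(** * Faces as cosets of group elements *)

Local Notation face_type := (coset_face G rho).
Local Notation le := (@coset_le gT d G rho).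
Local Notation rk := (@coset_rank gT d G rho).

(** Incident faces are cosets with a common element, so a face is named by
    an element g of its coset.  The value for g outside G is arbitrary. *)
Definition face (g : gT) (i : 'I_d) : face_type :=
  if insub (i, gen_by rho [set~ i] :* g) is Some u then inr u else inl false.

Lemma face_inr g i : g \in G ->
  {u | face g i = inr u & val u = (i, gen_by rho [set~ i] :* g)}.
Proof.
move=> Gg; rewrite /face; case: insubP => [u _ uE|nGg]; first by exists u.
by case/rcosetsP: nGg; exists g.
Qed.

(** Case analysis that replaces a coset in the subtype by a representative. *)
Lemma face_case (P : face_type -> Prop) :
    (forall b, P (inl b)) -> (forall g i, g \in G -> P (face g i)) ->
  forall x, P x.
Proof.
move=> Pl Pf [b|u]; first exact: Pl.
have /rcosetsP[g Gg uE] := valP u.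
have [v fE vE] := face_inr (val u).1 Gg.
suff -> : inr u = face g (val u).1 by apply: Pf.
rewrite fE; congr inr; apply: val_inj; rewrite vE -uE; exact: surjective_pairing.
Qed.

Lemma rank_face g i : g \in G -> rk (face g i) = Posz i.
Proof. by case/(face_inr i)=> u -> /= ->. Qed.

Lemma face_neq_inl g i b : g \in G -> face g i <> inl b.
Proof. by case/(face_inr i)=> u -> _. Qed.

Lemma face_index g h i j : g \in G -> h \in G -> face g i = face h j -> i = j.
Proof.
move=> Gg Gh eq_gh; have := rank_face i Gg; rewrite eq_gh rank_face // => -[].
by move/val_inj.
Qed.

Lemma face_eqP g h i : g \in G -> h \in G ->
  reflect (face g i = face h i) (g * h^-1 \in gen_by rho [set~ i]).
Proof.
move=> Gg Gh; rewrite -mem_rcoset.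
have [u -> uE] := face_inr i Gg; have [v -> vE] := face_inr i Gh.
apply: (iffP rcoset_eqP) => [eq_gh|[uv]].
  by congr inr; apply: val_inj; rewrite uE vE eq_gh.
by move: uE; rewrite uv vE => -[].
Qed.

Lemma le_faceP g h (i j : 'I_d) : g \in G -> h \in G ->
  reflect ((i <= j)%N /\
           exists2 k, k \in G & face k i = face g i /\ face k j = face h j)
          (le (face g i) (face h j)).
Proof.
move=> Gg Gh.
have [u fu uE] := face_inr i Gg; have [v fv vE] := face_inr j Gh.
rewrite fu fv /= uE vE /=.
apply: (iffP andP) => [[le_ij /set0Pn[k /setIP[ki kj]]]|[le_ij [k Gk []]]].
  split=> //; have Gk: k \in G.
    move: ki; rewrite mem_rcoset => /mem_gen_by_sub.
    by rewrite groupMr ?groupV.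
  by exists k => //; rewrite -fu -fv; split; apply/face_eqP; rewrite // -mem_rcoset.
rewrite -fu -fv => /face_eqP ki /face_eqP kj; split=> //; apply/set0Pn; exists k.
by rewrite inE !mem_rcoset ki ?kj.
Qed.

Lemma le_face_common g (i j : 'I_d) : g \in G -> (i <= j)%N -> le (face g i) (face g j).
Proof. by move=> Gg le_ij; apply/le_faceP=> //; split=> //; exists g. Qed.

(** Write h * g^-1 = u * v with u generated below j and v above j.  The witness
    is v * g = u^-1 * h: the subgroups of the faces up to rank j contain v, and
    those of the faces from rank j on contain u. *)
Lemma splice g h j : g \in G -> h \in G -> face g j = face h j ->
  exists2 k, k \in G &
    (forall i : 'I_d, (i <= j)%N -> face k i = face g i) /\
    (forall i : 'I_d, (j <= i)%N -> face k i = face h i).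
Proof.
move=> Gg Gh /esym/face_eqP-/(_ Gh Gg)/gen_by_setC1_split[u Hu [v Hv hgE]].
have [Gu Gv] := (mem_gen_by_sub Hu, mem_gen_by_sub Hv).
have Gvg : v * g \in G by rewrite groupM.
exists (v * g) => //; split=> i le_ij; apply/face_eqP=> //.
  rewrite mulgK; apply: subsetP Hv; apply/gen_byS/subsetP=> k.
  by rewrite !inE => ltjk; rewrite -val_eqE neq_ltn (leq_ltn_trans le_ij) // orbT.
rewrite (_ : _ * h^-1 = u^-1); last first.
  by rewrite -mulgA -[g * _]invgK invMg invgK hgE invMg mulKVg.
rewrite groupV; apply: subsetP Hu; apply/gen_byS/subsetP=> k.
by rewrite !inE => ltjk; rewrite -val_eqE neq_ltn (leq_trans ltjk).
Qed.


Lemma le_face_inl g i b : g \in G -> le (face g i) (inl b) = b.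
Proof. by case/(face_inr i)=> u -> _; case: b. Qed.

Lemma le_inl_face g i b : g \in G -> le (inl b) (face g i) = ~~ b.
Proof. by case/(face_inr i)=> u -> _; case: b. Qed.

Lemma coset_le_refl : reflexive le.
Proof. by apply: face_case => [[]|g i Gg] //; apply: le_face_common. Qed.

Lemma coset_le_anti : antisymmetric le.
Proof.
apply: face_case => [b|g i Gg]; apply: face_case => [c|h j Gh] //.
- by case: b c => [] [].
- by rewrite le_face_inl // le_inl_face //; case: b.
- by rewrite le_face_inl // le_inl_face //; case: c.
case/andP=> /le_faceP-/(_ Gg Gh)[le_ij [k Gk [<- kj]]].
case/le_faceP=> // le_ji _.
suff ij : i = j by move: kj; rewrite -ij.
by apply/val_inj/eqP; rewrite /= eqn_leq le_ij.
Qed.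

Lemma coset_le_trans : transitive le.
Proof.
move=> y x z; move: y x z.
apply: face_case => [b|h j Gh]; apply: face_case => [a|g i Gg];
  apply: face_case => [c|k l Gk];
  rewrite ?le_face_inl ?le_inl_face //; try by move: a b c => [] [] [].
- by move: a b => [] [].
- by move: b c => [] [].
- by case: b.
- by case: a c => [] [].
case/le_faceP=> // le_ij [x Gx [xi xj]]; case/le_faceP=> // le_jl [y Gy [yj yl]].
have [z Gz [zl zr]] := splice Gx Gy (etrans xj (esym yj)).
apply/le_faceP=> //; split; first exact: leq_trans le_jl.
by exists z => //; rewrite zl // zr.
Qed.

(** * Flags as group elements *)

Definition flag_at (g : gT) : {set face_type} :=
  inl false |: (inl true |: [set face g i | i : 'I_d]).

Lemma mem_flag_inl g b : inl b \in flag_at g.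
Proof. by rewrite !inE; case: b; rewrite eqxx ?orbT. Qed.

Lemma mem_flag_face g i : face g i \in flag_at g.
Proof. by rewrite !inE imset_f ?orbT. Qed.

Lemma flag_at_face g h i : g \in G -> h \in G ->
  (face h i \in flag_at g) = (face h i == face g i).
Proof.
move=> Gg Gh; apply/idP/eqP=> [|->]; last exact: mem_flag_face.
rewrite !inE => /or3P[/eqP/face_neq_inl|/eqP/face_neq_inl|/imsetP[j _ hE]]; try by case.
by rewrite hE; move/(face_index Gh Gg): hE => ->.
Qed.

Lemma flag_at_sub g (A : {set face_type}) :
    (forall b, inl b \in A) -> (forall i, face g i \in A) ->
  flag_at g \subset A.
Proof.
move=> Al Af; apply/subsetP=> x; rewrite !inE.
by case/or3P=> [/eqP->|/eqP->|/imsetP[i _ ->]].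
Qed.

Lemma card_flag_at g : g \in G -> #|flag_at g| = d.+2.
Proof.
move=> Gg; have nl b : inl b \notin [set face g i | i : 'I_d].
  by apply/imsetP=> [[i _ /esym/face_neq_inl]]; apply.
rewrite /flag_at !cardsU1 nl !inE negb_or nl /= card_imset ?card_ord //.
by move=> i j; apply: face_index.
Qed.

Lemma chain_flag_at g : g \in G -> chain le (flag_at g).
Proof.
move=> Gg; apply/forall_inP=> x; rewrite !inE => gx.
apply/forall_inP=> y; rewrite !inE.
case/or3P: gx => [/eqP->|/eqP->|/imsetP[i _ ->]] //; first by case: y => [[]|].
case/or3P=> [/eqP->|/eqP->|/imsetP[j _ ->]]; rewrite ?le_face_inl ?le_inl_face //.
by apply/orP; have [|/ltnW] := leqP i j => ?; [left | right]; apply: le_face_common.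
Qed.

(** Induction on the rank: an element that represents the faces of A below
    rank k is glued to one that represents the next face, by [splice]. *)
Lemma chain_sub_flag A : chain le A -> exists2 g, g \in G & A \subset flag_at g.
Proof.
move=> /forall_inP chA.
have total x y : x \in A -> y \in A -> le x y || le y x.
  by move=> /chA/forall_inP; apply.
pose good k g := forall (i : 'I_d) h,
  (i < k)%N -> h \in G -> face h i \in A -> face h i = face g i.
suff [g Gg gG] : exists2 g, g \in G & good d g.
  exists g => //; apply/subsetP; apply: face_case => [b _|h i Gh Ah].
    exact: mem_flag_inl.
  by rewrite flag_at_face // (gG i h).
elim: {-2}d (leqnn d) => [|k IHk] ltkd; first by exists 1.
have [g Gg gG] := IHk (ltnW ltkd).
pose k' := Ordinal ltkd.
have [/existsP[h /andP[Gh Ah]]|noA] :=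
    boolP [exists h, (h \in G) && (face h k' \in A)]; last first.
  exists g => // i h; rewrite ltnS leq_eqVlt => /predU1P[ik|ltik] Gh Ah; last exact: gG.
  case/existsP: noA; exists h; rewrite Gh /=.
  by have -> : k' = i by apply: val_inj.
have uniq_k h' : h' \in G -> face h' k' \in A -> face h' k' = face h k'.
  move=> Gh' Ah'; have := total _ _ Ah Ah'.
  by case/orP=> /le_faceP[] // _ [m _ [<- <-]].
(* The new face k is incident to the last face j of A before it, so the flags *)
(* through g and through h can be glued at j, and A has no face between them. *)
pose J := [pred i : 'I_d | (i < k)%N && (face g i \in A)].
have [j Jj|noJ] := pickP J; last first.
  exists h => // i h'; rewrite ltnS leq_eqVlt => /predU1P[ik|ltik] Gh' Ah'.
    by have ik' : i = k' by [apply: val_inj]; rewrite ik' in Ah' *; apply: uniq_k.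
  by have := noJ i; rewrite /= ltik -(gG _ _ ltik Gh' Ah') Ah'.
case: (arg_maxnP (fun i : 'I_d => val i) Jj) => {Jj}j /= /andP[ltjk Aj] maxj.
have [m Gm [mj mk]] : exists2 m, m \in G & face m j = face g j /\ face m k' = face h k'.
  case/orP: (total _ _ Aj Ah) => [/le_faceP-/(_ Gg Gh)[_ [m]]|]; first by exists m.
  by case/le_faceP=> //; rewrite leqNgt ltjk.
have [g' Gg' [g'l g'r]] := splice Gg Gm (esym mj).
exists g' => // i h'; rewrite ltnS leq_eqVlt => /predU1P[ik|ltik] Gh' Ah'.
  have ik' : i = k' by [apply: val_inj].
  by rewrite ik' in Ah' *; rewrite g'r ?mk; [apply: uniq_k | apply: ltnW].
have h'g := gG _ _ ltik Gh' Ah'.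
by rewrite h'g g'l //; apply: maxj; rewrite /= ltik -h'g.
Qed.

Lemma flag_flag_at g : g \in G -> flag le (flag_at g).
Proof.
move=> Gg; apply/maxsetP; split=> [|B chB gB]; first exact: chain_flag_at.
have [h Gh Bh] := chain_sub_flag chB.
apply/eqP; rewrite eq_sym eqEcard gB.
by rewrite card_flag_at // -(card_flag_at Gh) subset_leq_card.
Qed.

(** A chain lies in some [flag_at g], which is itself a chain: these are the
    maximal chains. *)
Lemma flagP A : reflect (exists2 g, g \in G & A = flag_at g) (flag le A).
Proof.
apply: (iffP idP) => [/maxsetP[chA maxA]|[g Gg ->]]; last exact: flag_flag_at.
have [g Gg sAg] := chain_sub_flag chA.
by exists g => //; rewrite (maxA _ (chain_flag_at Gg)).
Qed.

(** Induction along walks of flags: multiplication on the left by rho_i changes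
    at most the i-face of the flag of g. *)
Lemma string_group_ind (P : gT -> Prop) : P 1 ->
  (forall i g, g \in G -> P g -> P (tnth rho i * g)) -> forall g, g \in G -> P g.
Proof.
move=> P1 Pmul g; rewrite -{1}gen_by_setT => /gen_prodgP[m [c cP ->]].
elim: m c cP => [|m IHm] c cP; first by rewrite big_ord0.
rewrite big_ord_recl; have /imsetP[i _ ->] := cP ord0; apply: Pmul; last exact: IHm.
apply: group_prod => j _; have /imsetP[l _ ->] := cP (lift ord0 j).
exact: tnth_rho_in.
Qed.

Lemma face_rho_other g i j : g \in G -> j != i -> face (tnth rho i * g) j = face g j.
Proof.
move=> Gg ne_ji; apply/face_eqP; rewrite ?(groupM (tnth_rho_in i)) //.
by rewrite mulgK mem_gen_by // !inE eq_sym.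
Qed.

(** * Consequences of the intersection property *)

Hypothesis intersG : forall I J : {set 'I_d},
    gen_by rho I :&: gen_by rho J = gen_by rho (I :&: J) :> {set gT}.

Lemma rho_notin_setC1 i : tnth rho i \notin gen_by rho [set~ i].
Proof.
apply/negP=> ri; have : tnth rho i \in gen_by rho [set i] :&: gen_by rho [set~ i].
  by rewrite inE ri mem_gen_by // set11.
by rewrite intersG setICr gen_by0 inE (negPf (rho_neq1 i)).
Qed.

Lemma face_rho_neq g i : g \in G -> face (tnth rho i * g) i <> face g i.
Proof.
move=> Gg /face_eqP; rewrite mulgK (negPf (rho_notin_setC1 i)).
by move=> H; have := H (groupM (tnth_rho_in i) Gg) Gg.
Qed.

(** The intersection property, applied to the maximal parabolic subgroups
    that contain [gen_by rho I]. *)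
Lemma gen_by_bigcap (I : {set 'I_d}) x : x \in G ->
  (forall i, i \notin I -> x \in gen_by rho [set~ i]) -> x \in gen_by rho I.
Proof.
move=> Gx xI.
suff H (s : seq 'I_d) : {subset s <= ~: I} -> x \in gen_by rho [set i | i \notin s].
  have := H (enum (~: I)).
  suff -> : [set i | i \notin enum (~: I)] = I by apply=> i; rewrite mem_enum.
  by apply/setP=> i; rewrite inE mem_enum inE negbK.
elim: s => [_|i s IHs sI].
  by rewrite (_ : finset _ = setT) ?gen_by_setT //; apply/setP=> i; rewrite !inE.
have -> : [set j | j \notin i :: s] = [set~ i] :&: [set j | j \notin s].
  by apply/setP=> j; rewrite !inE negb_or.
rewrite -intersG inE xI ?IHs // => [j sj|].
  by apply: sI; rewrite inE sj orbT.
by have := sI i; rewrite !inE eqxx; apply.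
Qed.

(** The subgroups of all the faces intersect in the trivial group. *)
Lemma flag_at_inj g h : g \in G -> h \in G -> flag_at g = flag_at h -> g = h.
Proof.
move=> Gg Gh eq_gh; apply/eqP; rewrite eq_mulgV1 -in_set1.
have -> : [set 1] = gen_by rho set0 by rewrite gen_by0.
apply: gen_by_bigcap => [|i _]; first by rewrite groupM ?groupV.
by apply/face_eqP=> //; apply/eqP; rewrite -flag_at_face // -eq_gh mem_flag_face.
Qed.

Lemma gen_by1P i x : reflect (x = 1 \/ x = tnth rho i) (x \in gen_by rho [set i]).
Proof.
rewrite gen_by1 /= (cycle2g (order_rho i)) !inE.
by apply: (iffP orP) => [[/eqP|/eqP]|[->|->]]; auto.
Qed.

(** The subgroups of the faces of the ranks other than i intersect in the
    subgroup generated by rho_i, which has order 2. *)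
Lemma adjacent_rho g h i : g \in G -> h \in G ->
  (forall j, j != i -> face h j = face g j) -> h = g \/ h = tnth rho i * g.
Proof.
move=> Gg Gh eq_hg.
have /gen_by1P[hg1|hgr]: h * g^-1 \in gen_by rho [set i].
- apply: gen_by_bigcap; first by rewrite groupM ?groupV.
  by move=> j; rewrite inE => ne_ji; apply/face_eqP/eq_hg.
- by left; apply/eqP; rewrite eq_mulgV1 hg1.
by right; rewrite -hgr mulgKV.
Qed.

(** * The coset poset is a polytope *)

Lemma rank_inl b x : rk x = rk (inl b) -> x = inl b.
Proof.
elim/face_case: x => [c|g i Gg]; first by case: b c => [] [].
by rewrite rank_face //; case: b => // -[id]; have := ltn_ord i; rewrite id ltnn.
Qed.

Lemma flag_at_rank g x (i : 'I_d) :
  g \in G -> x \in flag_at g -> rk x = Posz i -> x = face g i.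
Proof.
move=> Gg gx rx; elim/face_case: x => [b|h j Gh] in gx rx *.
  have := rank_inl (etrans (rank_face i Gg) (esym rx)).
  by move/face_neq_inl; case.
move: rx; rewrite rank_face // => -[/val_inj ji].
by move: gx; rewrite ji flag_at_face // => /eqP.
Qed.

Lemma rank_lt x y : x != y -> le x y -> (rk x < rk y)%R.
Proof.
elim/face_case: x => [b|g i Gg]; elim/face_case: y => [c|h j Gh].
- by case: b c => [] [].
- by rewrite le_inl_face // rank_face //; case: b.
- by rewrite le_face_inl // rank_face //; case: c => // _ _; apply: ltn_ord.
move=> neq /le_faceP-/(_ Gg Gh)[le_ij [k _ [ki kj]]]; rewrite !rank_face //.
rewrite ltz_nat ltn_neqAle le_ij andbT; apply: contraNneq neq => /val_inj ij.
by rewrite -ki -kj ij.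
Qed.

Lemma flag_at_lt g x y : g \in G -> x \in flag_at g -> y \in flag_at g ->
  (rk x < rk y)%R -> (x != y) && le x y.
Proof.
move=> Gg gx gy ltxy; have nxy : x != y by apply: contraTneq ltxy => ->; rewrite ltxx.
rewrite nxy /=; have /forall_inP/(_ x gx)/forall_inP/(_ y gy) := chain_flag_at Gg.
case/orP=> // leyx; move: ltxy; rewrite ltNge le_eqVlt orbC rank_lt //.
by rewrite eq_sym.
Qed.

Lemma chain_add (A : {set face_type}) x : chain le A ->
  {in A, forall y, le x y || le y x} -> chain le (x |: A).
Proof.
move=> /forall_inP chA Ax; apply/forall_inP=> y Ay; apply/forall_inP=> z Az.
case/setU1P: Ay => [->|Ay]; case/setU1P: Az => [->|Az].
- by rewrite coset_le_refl.
- exact: Ax.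
- by rewrite orbC Ax.
exact: (forall_inP (chA y Ay)).
Qed.

Lemma chain1 x : chain le [set x].
Proof.
by apply/forall_inP=> y /set1P->; apply/forall_inP=> z /set1P->; rewrite coset_le_refl.
Qed.

Lemma flag_at_off g h i x : g \in G -> h \in G ->
    (forall j, j != i -> face h j = face g j) ->
  x \in flag_at g -> rk x != Posz i -> x \in flag_at h.
Proof.
move=> Gg Gh hg gx; elim/face_case: x => [b|k j Gk] in gx *.
  by rewrite mem_flag_inl.
rewrite rank_face // eqz_nat val_eqE => /hg hgj.
by move: gx; rewrite !flag_at_face // hgj.
Qed.

(** If x and y belong to the flag of g and i is the rank between theirs, then the
    two faces between x and y are those of rank i of g and of rho_i * g.  A
    face between them lies in the flag of some k through x and y, and k * g^-1
    is generated by the rho_j with j distinct from i - 1 and i + 1; so it is the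
    product of an element of the subgroup of i-faces and a power of rho_i. *)
Lemma coset_diamond x y : x != y -> le x y -> (rk y - rk x = 2)%R ->
  #|[set z | ((x != z) && le x z) && ((z != y) && le z y)]| = 2.
Proof.
move=> neq_xy le_xy rxy.
have [g Gg /subsetP gxy] : exists2 g, g \in G & [set x; y] \subset flag_at g.
  apply/chain_sub_flag/chain_add; first exact: chain1.
  by move=> _ /set1P->; rewrite le_xy.
have gx : x \in flag_at g by apply: gxy; rewrite !inE eqxx.
have gy : y \in flag_at g by apply: gxy; rewrite !inE eqxx orbT.
(* The bounds on the ranks of x and y make i a proper rank, even when x is the *)
(* least face or y is the greatest one. *)
have [i ri] : exists i : 'I_d, rk x = (Posz i - 1)%R.
  have ryd : (rk y <= d%:Z)%R.
    elim/face_case: {neq_xy le_xy rxy gxy gy}y => [[]|h j Gh] //.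
    by rewrite rank_face // lez_nat ltnW.
  move: rxy; elim/face_case: {neq_xy le_xy gxy gx}x => [[]|h j Gh] /= rxy.
  - by move: rxy ryd; lia.
  - have d0 : (0 < d)%N by move: rxy ryd; lia.
    by exists (Ordinal d0).
  rewrite rank_face // in rxy *; have jd : (j.+1 < d)%N by move: rxy ryd; lia.
  by exists (Ordinal jd); rewrite /=; lia.
have ry : rk y = (Posz i + 1)%R by lia.
set h := tnth rho i * g; have Gh : h \in G by rewrite groupM ?tnth_rho_in.
have hg j : j != i -> face h j = face g j by apply: face_rho_other.
have hx : x \in flag_at h.
  by apply: (flag_at_off Gg Gh hg) => //; rewrite ri; clear; lia.
have hy : y \in flag_at h.
  by apply: (flag_at_off Gg Gh hg) => //; rewrite ry; clear; lia.
suff -> : [set z | ((x != z) && le x z) && ((z != y) && le z y)]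
          = [set face g i; face h i].
  by rewrite cards2 eq_sym; case: eqP => // /face_rho_neq-/(_ Gg).
have between k : k \in G -> x \in flag_at k -> y \in flag_at k ->
    ((x != face k i) && le x (face k i)) && ((face k i != y) && le (face k i) y).
  move=> Gk kx ky; apply/andP.
  by split; apply: (flag_at_lt Gk) => //; rewrite ?mem_flag_face // rank_face //;
    rewrite ?ri ?ry; clear; lia.
apply/setP=> z; rewrite !inE; apply/idP/orP=> [|[]/eqP->]; try exact: between.
case/andP=> /andP[neq_xz le_xz] /andP[neq_zy le_zy].
have [k Gk /subsetP kxy] : exists2 k, k \in G & [set z; x; y] \subset flag_at k.
  rewrite -setUA; apply/chain_sub_flag/chain_add.
    by apply/chain_add=> [|_ /set1P->]; [apply: chain1 | rewrite le_xy].
  by move=> _ /set2P[]->; rewrite ?le_xz ?le_zy ?orbT.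
have [kz kx ky]: [/\ z \in flag_at k, x \in flag_at k & y \in flag_at k].
  by split; apply: kxy; rewrite !inE eqxx ?orbT.
have -> : z = face k i.
  apply: flag_at_rank => //.
  by move: (rank_lt neq_xz le_xz) (rank_lt neq_zy le_zy) ri ry; clear; lia.
have near_i (j : 'I_d) : (j.+1 == i :> nat) || (j == i.+1 :> nat) -> face k j = face g j.
  case/orP=> /eqP ij.
    have rxj : rk x = Posz j by move: ri ij; clear; lia.
    by rewrite -(flag_at_rank Gg gx rxj) -(flag_at_rank Gk kx rxj).
  have ryj : rk y = Posz j by move: ry ij; clear; lia.
  by rewrite -(flag_at_rank Gg gy ryj) -(flag_at_rank Gk ky ryj).
pose far := [set j : 'I_d | (i.+1 < j)%N || (j.+1 < i)%N].
have : k * g^-1 \in gen_by rho (far :|: [set i]).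
  apply: gen_by_bigcap => [|j]; first by rewrite groupM ?groupV.
  rewrite !inE negb_or -val_eqE /= => Hj; apply/face_eqP/near_i => //.
  by move: Hj; clear; lia.
rewrite gen_byU_far => [/mulsgP[b a Hb Ha kgE]|j _ Hj /set1P->]; last first.
  by move: Hj; rewrite inE orbC.
have far_i : gen_by rho far \subset gen_by rho [set~ i].
  by apply/gen_byS/subsetP=> j; rewrite !inE -val_eqE /=; clear; lia.
have Ga := mem_gen_by_sub Ha; have Gag: a * g \in G by rewrite groupM.
have -> : face k i = face (a * g) i.
  apply/face_eqP=> //; apply: subsetP far_i _ _.
  by rewrite invMg mulgA kgE mulgK.
by case/gen_by1P: Ha => ->; rewrite ?mul1g; [left | right].
Qed.

Lemma flag_at_diff g h i : g \in G -> h \in G ->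
    (forall j, j != i -> face h j = face g j) -> face h i <> face g i ->
  flag_at g :\: flag_at h = [set face g i].
Proof.
move=> Gg Gh hg hgi; apply/setP=> x; rewrite in_setD in_set1.
apply/andP/eqP=> [[nhx gx]|->]; last first.
  by rewrite mem_flag_face flag_at_face // eq_sym; split=> //; apply/eqP.
apply: flag_at_rank => //; apply/eqP; apply: contraR nhx.
exact: (flag_at_off Gg Gh hg gx).
Qed.

Lemma flag_adjacent_rho g i : g \in G ->
  flag_adjacent le (flag_at g) (flag_at (tnth rho i * g)).
Proof.
move=> Gg; have Gh : tnth rho i * g \in G by rewrite groupM ?tnth_rho_in.
have hg j : j != i -> face (tnth rho i * g) j = face g j by apply: face_rho_other.
have neq_hg := @face_rho_neq g i Gg.
apply/and4P; split; rewrite ?flag_flag_at //.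
  by rewrite (flag_at_diff Gg Gh hg) ?cards1.
by rewrite (flag_at_diff (i := i) Gh Gg) ?cards1 // => [j /hg->|/esym].
Qed.

Lemma flag_connected A B : flag le A -> flag le B -> connect (flag_adjacent le) A B.
Proof.
case/flagP=> a Ga -> /flagP[b Gb ->].
suff connM g : g \in G -> connect (flag_adjacent le) (flag_at a) (flag_at (g * a)).
  by rewrite -[b](mulgKV a); apply: connM; rewrite groupM ?groupV.
move: g; apply: string_group_ind => [|i g Gg IHg]; first by rewrite mul1g.
by apply: connect_trans IHg (connect1 _); rewrite -mulgA flag_adjacent_rho ?groupM.
Qed.

Theorem coset_polytope : polytope le rk d.
Proof.
split.
- split; [exact: coset_le_refl | exact: coset_le_anti | exact: coset_le_trans].
- split=> [|x y /andP[]]; last exact: rank_lt.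
  apply: face_case => [[]|g i Gg]; rewrite ?rank_face //=.
  by rewrite lez_nat ltnW.
- exists (inl false), (inl true); split=> [||A /flagP[g Gg ->]].
  + split=> [|x /(_ (inl false))].
      apply: face_case => [[]|g i Gg] //; by rewrite le_face_inl ?andbF.
    by rewrite andbT negbK => /eqP.
  + split=> [|x /(_ (inl true))].
      apply: face_case => [[]|g i Gg] //; by rewrite le_inl_face ?andbF.
    by case: x => [[]|] //.
  by rewrite card_flag_at ?mem_flag_inl.
- by move=> x y /andP[]; apply: coset_diamond.
exact: flag_connected.
Qed.

(** * Automorphisms of the coset poset *)

(** Right translation; for g outside G it is the identity, so that it is a
    permutation for every g. *)
Definition translate_fun (g : gT) (x : face_type) : face_type :=
  match x with
  | inl b => inl b
  | inr u => if g \in G then inr (insubd u ((val u).1, (val u).2 :* g)) else inr u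
  end.

Lemma translate_fun_face g h i : g \in G -> h \in G ->
  translate_fun g (face h i) = face (h * g) i.
Proof.
move=> Gg Gh; have [u -> uE] := face_inr i Gh.
have [v -> vE] := face_inr i (groupM Gh Gg).
rewrite /translate_fun Gg; congr inr; apply: val_inj.
rewrite val_insubd uE vE -rcosetM; case: ifP => // /negP[].
by apply/rcosetsP; exists (h * g) => //; apply: groupM.
Qed.

Lemma translate_inj g : injective (translate_fun g).
Proof.
have [Gg|nGg] := boolP (g \in G); last first.
  by move=> [b|u] [c|v]; rewrite /translate_fun ?(negPf nGg).
apply: (can_inj (g := translate_fun g^-1)).
apply: face_case => [b|h i Gh] //.
by rewrite !translate_fun_face ?groupM ?groupV ?mulgK.
Qed.

Definition translate (g : gT) : {perm face_type} := perm (@translate_inj g).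

Lemma translate_inl g b : translate g (inl b) = inl b.
Proof. by rewrite permE. Qed.

Lemma translate_face g h i : g \in G -> h \in G ->
  translate g (face h i) = face (h * g) i.
Proof. by move=> Gg Gh; rewrite permE translate_fun_face. Qed.

Lemma translateM : {in G &, {morph translate : g h / g * h}}.
Proof.
move=> g h Gg Gh; apply/permP; apply: face_case => [b|k i Gk].
  by rewrite permM !translate_inl.
by rewrite permM !translate_face ?groupM ?mulgA.
Qed.

Lemma translate_flag_at g h : g \in G -> h \in G ->
  translate g @: flag_at h = flag_at (h * g).
Proof.
move=> Gg Gh; apply/eqP; rewrite eq_sym eqEcard card_imset; last exact: perm_inj.
rewrite !card_flag_at ?groupM //.
rewrite leqnn andbT; apply: flag_at_sub => [b|i].
  by rewrite -(translate_inl g b) imset_f ?mem_flag_inl.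
by rewrite -translate_face // imset_f ?mem_flag_face.
Qed.

Lemma polytope_autP (f : {perm face_type}) :
  reflect ({homo f : x y / le x y} /\ forall x, rk (f x) = rk x)
          (f \in polytope_aut le rk).
Proof.
rewrite inE; apply: (iffP andP) => [[/forallP fle /'forall_eqP frk]|[fle frk]].
  by split=> // x y; have /forallP/(_ y)/implyP := fle x.
split; last by apply/'forall_eqP.
by apply/forallP=> x; apply/forallP=> y; apply/implyP/fle.
Qed.

Lemma translate_aut g : g \in G -> translate g \in polytope_aut le rk.
Proof.
move=> Gg; apply/polytope_autP; split=> [x y|]; last first.
  apply: face_case => [b|h i Gh]; first by rewrite translate_inl.
  by rewrite translate_face ?rank_face ?groupM.
elim/face_case: x => [b|h i Gh]; elim/face_case: y => [c|k j Gk];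
  rewrite ?translate_inl ?translate_face // ?le_inl_face ?le_face_inl ?groupM //.
case/le_faceP=> // le_ij [m Gm [mi mj]]; apply/le_faceP; rewrite ?groupM //.
by split=> //; exists (m * g); rewrite ?groupM // -!translate_face ?mi ?mj.
Qed.

Lemma aut_flag_at f h : f \in polytope_aut le rk -> h \in G ->
  exists2 g, g \in G & f @: flag_at h = flag_at g.
Proof.
case/polytope_autP=> fle _ Gh.
have /chain_sub_flag[g Gg sfg] : chain le (f @: flag_at h).
  apply/forall_inP=> _ /imsetP[x hx ->]; apply/forall_inP=> _ /imsetP[y hy ->].
  have /forall_inP/(_ x hx)/forall_inP/(_ y hy) := chain_flag_at Gh.
  by case/orP=> /fle->; rewrite ?orbT.
exists g => //; apply/eqP; rewrite eqEcard sfg card_imset; last exact: perm_inj.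
by rewrite /= !card_flag_at ?leqnn.
Qed.

(** The image of the base flag determines g.  Both maps then agree on every
    flag, by induction along adjacent flags: the i-adjacent flag is unique. *)
Lemma aut_translate f : f \in polytope_aut le rk ->
  exists2 g, g \in G & f = translate g.
Proof.
move=> autf; have [_ frk] := polytope_autP _ autf.
have image h g i : h \in G -> g \in G -> f @: flag_at h = flag_at g ->
    f (face h i) = face g i.
  move=> Gh Gg fhg; apply: flag_at_rank => //; last by rewrite frk rank_face.
  by rewrite -fhg imset_f ?mem_flag_face.
have [g Gg fg] := aut_flag_at autf (group1 G); exists g => //.
apply/permP; apply: face_case => [b|h i Gh].
  by rewrite translate_inl; apply: rank_inl; rewrite frk.
rewrite translate_face //; move: h Gh i; apply: string_group_ind => [|i h Gh IHh] j.
  by rewrite mul1g; apply: image.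
have Grh : tnth rho i * h \in G by rewrite groupM ?tnth_rho_in.
have [k Gk fk] := aut_flag_at autf Grh.
have fE l : f (face (tnth rho i * h) l) = face k l by apply: image.
have Ghg : h * g \in G by rewrite groupM.
have [l ne_li|khg|krhg] := @adjacent_rho (h * g) k i Ghg Gk.
- by rewrite -fE face_rho_other // IHh.
- case: (@face_rho_neq h i Gh); apply: (@perm_inj _ f).
  by rewrite fE IHh khg.
by rewrite fE krhg mulgA.
Qed.

Theorem coset_regular : regular_polytope le rk d.
Proof.
split; first exact: coset_polytope.
apply/imsetP; exists (flag_at 1); first by rewrite inE flag_flag_at.
apply/setP=> A; rewrite inE; apply/flagP/imsetP=> [[g Gg ->]|[f autf ->]].
  exists (translate g); first exact: translate_aut.
  by rewrite /= setactE -[g in LHS]mul1g -translate_flag_at.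
by have [g Gg fg] := aut_flag_at autf (group1 G); exists g.
Qed.

Canonical translate_morphism := Morphism translateM.

Lemma injm_translate : 'injm translate_morphism.
Proof.
apply/injmP=> g h Gg Gh eq_gh; apply: flag_at_inj => //.
by rewrite -[g]mul1g -[h]mul1g -!translate_flag_at //= eq_gh.
Qed.

Lemma translate_isom : isom G (polytope_aut le rk) translate_morphism.
Proof.
suff -> : polytope_aut le rk = (translate_morphism @* G)%G.
  by apply/isomP; split; first exact: injm_translate.
apply/setP=> f; apply/idP/morphimP=> [/aut_translate[g Gg ->]|[g _ Gg ->]].
  by exists g.
exact: translate_aut.
Qed.

(** Left multiplication by rho_i is right multiplication by its conjugate:
    rho_i * g = g * rho_i ^ g. *)
Lemma distinguished_translate g (i : 'I_d) : g \in G ->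
  distinguished_aut le rk (flag_at g) i (translate (tnth rho i ^ g)).
Proof.
move=> Gg; have Gr := tnth_rho_in i; have Grg := groupJ Gr Gg.
have Gh : tnth rho i * g \in G by rewrite groupM.
have hg j : j != i -> face (tnth rho i * g) j = face g j by apply: face_rho_other.
rewrite /distinguished_aut translate_flag_at // -conjgC; split.
- exact: translate_aut.
- exact: flag_flag_at.
- apply/eqP=> /(flag_at_inj Gh Gg)/(canRL (mulgK g)).
  by rewrite mulgV; apply/eqP/rho_neq1.
apply/setP=> x; rewrite [LHS]in_set [RHS]in_set; apply: andb_id2r => nix.
apply/idP/idP=> hx; last exact: (flag_at_off Gg Gh hg hx nix).
by apply: (flag_at_off Gh Gg _ hx nix) => j /hg->.
Qed.

Theorem coset_corresponds : corresponds_to le rk G rho.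
Proof.
exists (flag_at 1), translate_morphism; split.
- exact: flag_flag_at.
- exact: translate_isom.
by move=> i; rewrite tnth_map /= -{1}(conjg1 (tnth rho i)); apply: distinguished_translate.
Qed.

(** For the base flag of g, the distinguished generators are the translations by
    the conjugates of the rho_i by g, which have the same orders. *)
Theorem coset_schlafli : schlafli_type le rk d (string_type rho).
Proof.
move=> A /flagP[g Gg ->].
exists (map_tuple (fun x => translate (x ^ g)) rho) => [i|].
  by rewrite tnth_map; apply: distinguished_translate.
apply/eq_in_map=> i; rewrite mem_iota => /andP[i_gt0 ltid].
have [ltid' ltid1] : (i < d)%N /\ (i.-1 < d)%N by lia.
have rhoE k : (k < d)%N ->
    nth 1 (map_tuple (fun x => translate (x ^ g)) rho) k
      = translate (nth 1 rho k ^ g) /\ nth 1 rho k \in G.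
  move=> ltkd; rewrite (nth_map 1) ?size_tuple //; split=> //.
  by rewrite -(tnth_nth 1 rho (Ordinal ltkd)) tnth_rho_in.
have [-> Gi] := rhoE _ ltid'; have [-> Gi1] := rhoE _ ltid1.
rewrite -translateM ?groupJ // -conjMg.
by rewrite (order_injm injm_translate) ?orderJ ?groupJ ?groupM.
Qed.

End StringGroup.


(** * String C-groups of rank three *)

Local Notation i0 := (@Ordinal 3 0 isT).
Local Notation i1 := (@Ordinal 3 1 isT).
Local Notation i2 := (@Ordinal 3 2 isT).

Lemma ord3P (i : 'I_3) : [\/ i = i0, i = i1 | i = i2].
Proof.
by case: i => [[|[|[|//]]] lti];
  [apply: Or31 | apply: Or32 | apply: Or33]; apply: val_inj.
Qed.

(** If rho_0 were in < rho_1, rho_2 >, it would be in < rho_1 >, hence equal to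
    rho_1; and likewise for rho_2.  As < rho_0, rho_2 > is the product of
    < rho_0 > and < rho_2 >, this settles its intersections with the two other
    subgroups.  Each remaining case is an intersection of these. *)
Lemma string_C_group_rank3 (gT : finGroupType) (G : {group gT}) (rho : 3.-tuple gT) :
    string_group G rho ->
    gen_by rho [set~ i2] :&: gen_by rho [set~ i0] \subset gen_by rho [set i1] ->
    tnth rho i0 != tnth rho i1 -> tnth rho i2 != tnth rho i1 ->
  string_C_group G rho.
Proof.
move=> sG /subsetP H20 neq01 neq21; split=> // I J.
have rho0 : tnth rho i0 \notin gen_by rho [set~ i0].
  apply: contra neq01 => r0.
  have /(gen_by1P sG)[/eqP|->//] : tnth rho i0 \in gen_by rho [set i1].
    by apply: H20; rewrite inE r0 mem_gen_by ?inE.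
  by rewrite (negPf (rho_neq1 sG _)).
have rho2 : tnth rho i2 \notin gen_by rho [set~ i2].
  apply: contra neq21 => r2.
  have /(gen_by1P sG)[/eqP|->//] : tnth rho i2 \in gen_by rho [set i1].
    by apply: H20; rewrite inE r2 mem_gen_by ?inE.
  by rewrite (negPf (rho_neq1 sG _)).
have split1 x : x \in gen_by rho [set~ i1] ->
    exists2 a, a \in gen_by rho [set i0]
      & exists2 b, b \in gen_by rho [set i2] & x = a * b.
  have -> : [set~ i1] = [set i0] :|: [set i2].
    by apply/setP=> i; case: (ord3P i) => ->; rewrite !inE.
  rewrite (gen_byU_far sG) => [/mulsgP[a b Ha Hb ->]|_ _ /set1P-> /set1P->] //.
  by exists a => //; exists b.
have sub1 (i j : 'I_3) : i != j -> gen_by rho [set i] \subset gen_by rho [set~ j].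
  by move=> neq_ij; apply/gen_byS/subsetP=> k; rewrite !inE => /eqP->.
have H01 x : x \in gen_by rho [set~ i0] -> x \in gen_by rho [set~ i1] ->
    x \in gen_by rho [set i2].
  move=> x0 /split1[a /(gen_by1P sG)[->|->] [b Hb xE]]; first by rewrite xE mul1g.
  case/negP: rho0; rewrite -(mulgK b (tnth rho i0)) -xE groupM ?groupV //.
  exact: subsetP (sub1 i2 i0 isT) b Hb.
have H12 x : x \in gen_by rho [set~ i1] -> x \in gen_by rho [set~ i2] ->
    x \in gen_by rho [set i0].
  move=> /split1[a Ha [b /(gen_by1P sG)[->|->] xE]] x2; first by rewrite xE mulg1.
  case/negP: rho2; rewrite -(mulKg a (tnth rho i2)) -xE groupM ?groupV //.
  exact: subsetP (sub1 i0 i2 isT) a Ha.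
apply/eqP; rewrite eqEsubset; apply/andP; split; last first.
  by rewrite subsetI; apply/andP; split; apply: gen_byS; rewrite ?subsetIl ?subsetIr.
apply/subsetP=> x /setIP[xI xJ].
have xIJ i : i \notin I :&: J -> x \in gen_by rho [set~ i].
  have sub (K : {set 'I_3}) : i \notin K -> gen_by rho K \subset gen_by rho [set~ i].
    move=> nKi; apply/gen_byS/subsetP=> k Kk; rewrite !inE.
    by apply: contraNneq nKi => <-.
  by rewrite inE negb_and => /orP[/sub/subsetP|/sub/subsetP]; apply.
move: (mem_gen_by_sub sG xJ) xIJ => {xI xJ}; move: (I :&: J) => {I J}K Gx xK.
have sub (L : {set 'I_3}) : L \subset K -> x \in gen_by rho L -> x \in gen_by rho K.
  by move=> /(gen_byS rho)/subsetP; apply.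
have [K0|/xK x0] := boolP (i0 \in K); have [K1|/xK x1] := boolP (i1 \in K);
  have [K2|/xK x2] := boolP (i2 \in K).
- apply: (sub setT); last by rewrite (gen_by_setT sG).
  by apply/subsetP=> i _; case: (ord3P i) => ->.
- by apply: sub x2; apply/subsetP=> i; case: (ord3P i) => ->; rewrite ?inE.
- by apply: sub x1; apply/subsetP=> i; case: (ord3P i) => ->; rewrite ?inE.
- by apply: (sub [set i0]); rewrite ?sub1set ?H12.
- by apply: sub x0; apply/subsetP=> i; case: (ord3P i) => ->; rewrite ?inE.
- by apply: (sub [set i1]); rewrite ?sub1set ?H20 ?in_setI ?x0 ?x2.
- by apply: (sub [set i2]); rewrite ?sub1set ?H01.
have /(gen_by1P sG)[->|x_r2] := H01 _ x0 x1; first exact: group1.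
by case/negP: rho2; rewrite -x_r2.
Qed.

(** As s inverts s * t, it normalizes the cyclic subgroup of s * t. *)
Lemma gen_involutions (gT : finGroupType) (s t : gT) : s ^+ 2 = 1 -> t ^+ 2 = 1 ->
  <<[set s; t]>> \subset <[s * t]> * <[s]>.
Proof.
move=> s2 t2; have inv2 (x : gT) : x ^+ 2 = 1 -> x^-1 = x.
  by move/eqP; rewrite expgS expg1 -eq_invg_mul => /eqP.
have norm_s : <[s]> \subset 'N(<[s * t]>).
  have stJ : (s * t) ^ s = (s * t)^-1.
    by rewrite conjgE -mulgA mulKg invMg (inv2 s s2) (inv2 t t2).
  by rewrite cycle_subG inE -cycleJ stJ cycleV.
rewrite -norm_joinEr // gen_subG; apply/subsetP=> x /set2P[]->.
  by rewrite mem_gen // in_setU cycle_id orbT.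
by rewrite -{1}(mulKg s t) groupM ?groupV // mem_gen // in_setU cycle_id ?orbT.
Qed.

(** * The semidirect product *)

Section Semidirect.

Variables (m : nat) (D : finGroupType) (phi : {morphism [set: D] >-> autF2 m}).
Import GRing.Theory.

Lemma sd_mulE a b x y :
  SDPair phi a x * SDPair phi b y
  = SDPair phi (a + sgval (phi (x^-1)%g) b)%R (x * y).
Proof. by rewrite morphV ?inE. Qed.

Lemma sd_act1 a : sgval (phi 1) a = a.
Proof. by rewrite morph1 perm1. Qed.

Lemma sd_act0 x : sgval (phi x) 0%R = 0%R.
Proof. by apply: (addrI (sgval (phi x) 0%R)); rewrite -sd_actD !addr0. Qed.

Lemma sd_actMr x y a : sgval (phi (x * y)) a = sgval (phi y) (sgval (phi x) a).
Proof. by rewrite morphM ?inE // permM. Qed.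

Definition sd_incl (x : D) : semidirect phi := SDPair phi 0%R x.

Lemma sd_inclM : {in [set: D] &, {morph sd_incl : x y / x * y}}.
Proof. by move=> x y _ _; rewrite /sd_incl sd_mulE sd_act0 addr0. Qed.

Canonical sd_incl_morphism := Morphism sd_inclM.

Lemma injm_sd_incl : 'injm sd_incl_morphism.
Proof. by apply/injmP=> x y _ _ []. Qed.


Lemma sd_factor a (x : D) : SDPair phi a 1 * sd_incl x = SDPair phi a x.
Proof. by rewrite sd_mulE sd_act0 addr0 mul1g. Qed.

End Semidirect.

(** * Dihedral action on the vertices of the n-gon *)

Section DihedralModule.

Variables (n : nat) (hn : (3 <= n)%N) (D : finGroupType) (h0 h1 : D).
Variable (phi : {morphism [set: D] >-> autF2 n.-1}).
Hypotheses (genD : <<[set h0; h1]>> = [set: D]) (rot_n : (h0 * h1) ^+ n = 1).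
Hypotheses (h0_2 : h0 ^+ 2 = 1) (h1_2 : h1 ^+ 2 = 1).
Hypothesis (hphi : dihedral_rep h0 h1 phi).
Import GRing.Theory.

(** This is x_0 + x_k in the permutation module of Z/n; for k = 0 and for k = n
    it is 0, as no row has that number. *)
Definition vertex (k : nat) : 'cV['F_2]_n.-1 := (\col_i (i.+1 == k)%:R)%R.

Lemma vertex0 : vertex 0 = 0%R.
Proof. by apply/colP=> i; rewrite !mxE. Qed.

Lemma vertexn : vertex n = 0%R.
Proof. by apply/colP=> i; rewrite !mxE; case: eqP => // E; have := ltn_ord i; lia. Qed.

Lemma vertexS (j : 'I_n.-1) : vertex j.+1 = delta_mx j 0%R.
Proof. by apply/colP=> i; rewrite !mxE andbT eqSS. Qed.

Lemma vertex_eq0 k : (k < n)%N -> vertex k = 0%R -> k = 0%N.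
Proof.
case: k => // k ltkn; have ltk : (k < n.-1)%N by lia.
by rewrite (vertexS (Ordinal ltk)) => /colP/(_ (Ordinal ltk)); rewrite !mxE !eqxx.
Qed.

Lemma addvv (v : 'cV['F_2]_n.-1) : (v + v = 0)%R.
Proof. by apply/colP=> i; rewrite !mxE (addrr_pchar2 (pchar_Fp (isT : prime 2))). Qed.

(** x_0 + x_k is mapped to x_(-1) + x_(-1-k), the sum of x_0 + x_(-1-k) and of
    x_0 + x_(-1). *)
Lemma matU_vertex k : (k < n)%N ->
  (matU n *m vertex k = vertex (n.-1 - k) + vertex n.-1)%R.
Proof.
case: k => [|k] ltkn; first by rewrite vertex0 mulmx0 subn0 addvv.
have ltk : (k < n.-1)%N by lia.
rewrite (vertexS (Ordinal ltk)) -colE; apply/colP=> i; rewrite !mxE /=.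
have -> : (i.+1 == n.-1 - k.+1)%N = (i.+1 + k.+1 == n.-1)%N by lia.
case: (i.+1 =P n.-1) => [ilast|_] /=; last by rewrite addr0.
have -> : (i.+1 + k.+1 == n.-1)%N = false by lia.
by rewrite add0r.
Qed.

Lemma matV_vertex k : (k <= n)%N -> (matV n *m vertex k = vertex (n - k))%R.
Proof.
rewrite leq_eqVlt => /predU1P[->|]; first by rewrite vertexn mulmx0 subnn vertex0.
case: k => [|k] ltkn; first by rewrite subn0 vertex0 mulmx0 vertexn.
have ltk : (k < n.-1)%N by lia.
rewrite (vertexS (Ordinal ltk)) -colE; apply/colP=> i; rewrite !mxE /=.
by congr (_%:R)%R; congr nat_of_bool; have := ltn_ord i; lia.
Qed.

Lemma phi_h0 a : sgval (phi h0) a = (matU n *m a)%R.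
Proof. by case: hphi. Qed.

Lemma phi_h1 a : sgval (phi h1) a = (matV n *m a)%R.
Proof. by case: hphi. Qed.

Lemma involV (x : D) : x ^+ 2 = 1 -> x^-1 = x.
Proof. by move/eqP; rewrite expgS expg1 -eq_invg_mul => /eqP. Qed.

Lemma rotV : (h1 * h0)^-1 = h0 * h1.
Proof. by rewrite invMg !involV. Qed.

Lemma rot_vertex k : (k < n)%N ->
  sgval (phi (h0 * h1)) (vertex k) = (vertex k.+1 + vertex 1)%R.
Proof.
move=> ltkn; rewrite sd_actMr phi_h0 phi_h1 matU_vertex // mulmxDr.
by rewrite !matV_vertex; try lia; congr (vertex _ + vertex _)%R; lia.
Qed.

(** The edge x_0 + x_1 is rotated to the edge x_k + x_(k+1). *)
Lemma rot_pow_vertex1 k : (k < n)%N ->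
  sgval (phi ((h0 * h1) ^+ k)) (vertex 1) = (vertex k.+1 + vertex k)%R.
Proof.
elim: k => [_|k IHk ltkn]; first by rewrite sd_act1 vertex0 addr0.
rewrite expgSr sd_actMr IHk ?(ltnW ltkn) // sd_actD !rot_vertex ?(ltnW ltkn) //.
by rewrite addrACA addvv addr0.
Qed.

(** A rotation by a proper divisor k of n moves the edge x_0 + x_1, as k + 1 < n. *)
Lemma order_rot : #[h0 * h1] = n.
Proof.
have /dvdnP[q nE] : (#[h0 * h1] %| n)%N by rewrite order_dvdn rot_n.
have := expg_order (h0 * h1); move: (order_gt0 (h0 * h1)) nE.
move: #[_] => k k_gt0 nE rk.
have [//|neq_kn] := eqVneq k n.
have ltk : (k < n.-1)%N by case: q nE neq_kn => [|[|q]] nE; nia.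
have ltkn : (k < n)%N by lia.
have /colP/(_ (Ordinal ltk)) := rot_pow_vertex1 ltkn.
rewrite rk sd_act1 !mxE /= eqxx.
have -> : (k.+1 == 1)%N = false by lia.
by have -> : (k.+1 == k)%N = false by lia; rewrite addr0.
Qed.

Lemma h0_neq1 : h0 != 1.
Proof.
apply/eqP=> h01; have := @order_dvdn _ (h0 * h1) 2; rewrite h01 mul1g h1_2 eqxx.
by move/dvdn_leq; rewrite -[h1]mul1g -h01 order_rot => /(_ isT); lia.
Qed.

Lemma h1_neq1 : h1 != 1.
Proof.
apply/eqP=> h11; have := @order_dvdn _ (h0 * h1) 2; rewrite h11 mulg1 h0_2 eqxx.
by move/dvdn_leq; rewrite -[h0]mulg1 -h11 order_rot => /(_ isT); lia.
Qed.

Lemma h0_neq_h1 : h0 != h1.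
Proof.
apply/eqP=> h01; have := order_rot.
by rewrite h01 -[h1 * h1]/(h1 ^+ 2) h1_2 order1; lia.
Qed.

(** * The generators rho_0, rho_1, rho_2 *)

Local Notation rho := (rho_gens h0 h1 phi).
Local Notation rho0 := (SDPair phi 0%R h0).
Local Notation rho1 := (SDPair phi 0%R h1).
Local Notation rho2 := (SDPair phi (vertex n.-1) h0).

Lemma matU_last : (matU n *m vertex n.-1 = vertex n.-1)%R.
Proof. by rewrite matU_vertex ?subnn ?vertex0 ?add0r //; lia. Qed.

(** rho_1 rho_2 is the conjugate by x_0 of the rotation h1 h0, so the vector of
    its k-th power is the sum of x_0 and its image x_k by the k-th power of
    h0 h1. *)
Lemma rho12_pow k : (k <= n)%N ->
  (rho1 * rho2) ^+ k = SDPair phi (vertex k) ((h1 * h0) ^+ k).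
Proof.
have -> : rho1 * rho2 = SDPair phi (vertex 1) (h1 * h0).
  rewrite sd_mulE involV // phi_h1 matV_vertex ?add0r; last lia.
  by congr (SDPair phi (vertex _) _); lia.
elim: k => [_|k IHk ltkn]; first by rewrite vertex0.
rewrite expgS IHk ?(ltnW ltkn) // sd_mulE rotV rot_vertex // expgS.
by rewrite addrC -addrA addvv addr0.
Qed.

Lemma order_rho12 : #[rho1 * rho2] = n.
Proof.
have powz : (rho1 * rho2) ^+ n = 1.
  by rewrite rho12_pow // vertexn -[h1 * h0]invgK rotV expgVn rot_n invg1.
have dvdz : (#[rho1 * rho2] %| n)%N by rewrite order_dvdn powz.
have := dvdn_leq (leq_trans (isT : (0 < 3)%N) hn) dvdz; rewrite leq_eqVlt.
case/predU1P=> // ltzn; have := expg_order (rho1 * rho2).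
rewrite rho12_pow ?(ltnW ltzn) // => -[/(vertex_eq0 ltzn)].
by have := order_gt0 (rho1 * rho2); lia.
Qed.

Lemma order_rho01 : #[rho0 * rho1] = n.
Proof.
have -> : rho0 * rho1 = sd_incl phi (h0 * h1) by rewrite sd_inclM ?inE.
by rewrite (order_injm (injm_sd_incl phi)) ?inE // order_rot.
Qed.

Lemma rho02 : rho0 * rho2 = SDPair phi (vertex n.-1) 1.
Proof.
rewrite sd_mulE involV // phi_h0 matU_last add0r.
by rewrite -[h0 * h0]/(h0 ^+ 2) h0_2.
Qed.

Lemma rho20 : rho2 * rho0 = SDPair phi (vertex n.-1) 1.
Proof. by rewrite sd_mulE sd_act0 addr0 -[h0 * h0]/(h0 ^+ 2) h0_2. Qed.

Lemma transl_sq a : (SDPair phi a 1) ^+ 2 = 1.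
Proof. by rewrite expgS expg1 sd_mulE invg1 sd_act1 addvv mul1g. Qed.

Lemma rho0_sq : rho0 ^+ 2 = 1.
Proof.
rewrite expgS expg1 -(sd_inclM phi (in_setT h0) (in_setT h0)).
by rewrite -[h0 * h0]/(h0 ^+ 2) h0_2.
Qed.

Lemma rho1_sq : rho1 ^+ 2 = 1.
Proof.
rewrite expgS expg1 -(sd_inclM phi (in_setT h1) (in_setT h1)).
by rewrite -[h1 * h1]/(h1 ^+ 2) h1_2.
Qed.

Lemma rho2_sq : rho2 ^+ 2 = 1.
Proof.
rewrite expgS expg1 sd_mulE involV // phi_h0 matU_last addvv.
by rewrite -[h0 * h0]/(h0 ^+ 2) h0_2.
Qed.

(** The elements (rho_1 rho_2)^k, divided by their components in D, give all the
    unit vectors. *)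
Lemma gen_rho : gen_by rho [set: 'I_3] = [set: semidirect phi]%G.
Proof.
apply/eqP; rewrite -val_eqE /= eqEsubset subsetT /=; apply/subsetP=> -[a x] _.
set H := <<_>>; have Hrho (i : 'I_3) : tnth rho i \in H by rewrite mem_gen ?imset_f.
have [H0 H1 H2] : [/\ rho0 \in H, rho1 \in H & rho2 \in H].
  by split; [have := Hrho i0 | have := Hrho i1 | have := Hrho i2].
have Hincl y : sd_incl phi y \in H.
  have: sd_incl phi y \in sd_incl_morphism phi @* [set: D] by rewrite mem_morphim ?inE.
  have -> : sd_incl_morphism phi @* [set: D]
            = <<sd_incl_morphism phi @* [set h0; h1]>>.
    by rewrite -morphim_gen ?subsetT // genD.
  apply: subsetP; rewrite gen_subG; apply/subsetP=> _ /morphimP[z _ zh ->].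
  by case/set2P: zh => ->.
have Htr (b : 'cV_n.-1) : SDPair phi b 1 \in H.
  have -> : b = (\sum_j b j 0 *: vertex j.+1)%R.
    apply/colP=> i; rewrite summxE (bigD1 i) //= !mxE eqxx mulr1 big1 ?addr0 // => j ji.
    by rewrite !mxE eqSS eq_sym (negPf (ji : (val j != val i))) mulr0.
  apply: (big_ind (fun c => SDPair phi c 1 \in H)) => [|c c' Hc Hc'|j _].
  - exact: group1.
  - have -> : SDPair phi (c + c')%R 1 = SDPair phi c 1 * SDPair phi c' 1.
      by rewrite sd_mulE invg1 sd_act1 mulg1.
    exact: groupM.
  have Hv : SDPair phi (vertex j.+1) 1 \in H.
    have ltjn : (j.+1 <= n)%N by have := ltn_ord j; lia.
    have := groupX j.+1 (groupM H1 H2); rewrite rho12_pow //.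
    by rewrite -[SDPair _ _ (_ ^+ _)]sd_factor groupMr.
  case: (b j 0%R) => [[|[|//]]] ?.
    by rewrite (_ : Ordinal _ = 0%R) ?scale0r ?group1 //; apply: val_inj.
  by rewrite (_ : Ordinal _ = 1%R) ?scale1r //; apply: val_inj.
by rewrite -sd_factor groupM.
Qed.

Lemma string_group_rho : string_group [set: semidirect phi]%G rho.
Proof.
split; first exact: gen_rho.
- have order2 (x : semidirect phi) : x ^+ 2 = 1 -> x != 1 -> #[x] = 2.
    by apply: nt_prime_order.
  move=> i; case: (ord3P i) => ->; apply: order2.
  + exact: rho0_sq. + by apply: contra h0_neq1 => /eqP[->].
  + exact: rho1_sq. + by apply: contra h1_neq1 => /eqP[->].
  + exact: rho2_sq. + by apply: contra h0_neq1 => /eqP[_ ->].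
- move=> i j; case: (ord3P i) => ->; case: (ord3P j) => -> // _.
    by rewrite [_ * _]rho02 transl_sq.
  by rewrite [_ * _]rho20 transl_sq.
move=> i j; case: (ord3P i) => ->; case: (ord3P j) => -> // _; exists n.
- by lia.
- by rewrite -[in X in _ ^+ X]order_rho01 expg_order.
- by lia.
by rewrite -[in X in _ ^+ X]order_rho12 expg_order.
Qed.

Lemma gen_rho01 : gen_by rho [set~ i2] \subset sd_incl_morphism phi @* [set: D].
Proof.
rewrite gen_subG; apply/subsetP=> _ /imsetP[i neq_i ->].
by case: (ord3P i) neq_i => ->; rewrite ?inE // => _;
  apply: (mem_morphim (sd_incl_morphism phi)); rewrite inE.
Qed.

Lemma gen_rho12 : gen_by rho [set~ i0] \subset <[rho1 * rho2]> * <[rho1]>.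
Proof.
apply: subset_trans (gen_involutions rho1_sq rho2_sq).
apply/genS/subsetP=> _ /imsetP[i neq_i ->].
by case: (ord3P i) neq_i => ->; rewrite !inE // => _; rewrite eqxx ?orbT.
Qed.

(** An element of < rho_1, rho_2 > is (rho_1 rho_2)^k times a power of rho_1, and
    its vector is [vertex k]; for k < n, this vanishes only if k = 0. *)
Lemma string_C_group_rho : string_C_group [set: semidirect phi]%G rho.
Proof.
apply: (string_C_group_rank3 string_group_rho); first last.
- by apply: contra h0_neq_h1 => /eqP[_ ->].
- by apply: contra h0_neq_h1 => /eqP[->].
apply/subsetP=> g /setIP[/(subsetP gen_rho01)/morphimP[x _ _ ->]].
move=> /(subsetP gen_rho12)/mulsgP[_ r1b /cyclePmin[k ltk ->] r1 xE].
rewrite gen_by1; move: ltk xE; rewrite order_rho12 => ltkn xE.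
suff k0 : k = 0%N by rewrite xE k0 mul1g.
apply: vertex_eq0 => //.
have /morphimP[y _ _ yE] : r1b \in sd_incl_morphism phi @* [set: D].
  apply: subsetP r1; rewrite cycle_subG.
  by apply: (mem_morphim (sd_incl_morphism phi)); rewrite inE.
move: xE; rewrite yE rho12_pow ?(ltnW ltkn) // sd_mulE sd_act0 addr0.
by case.
Qed.

End DihedralModule.

(** * The regular polytope of type {n, n} *)

Theorem mainTheorem2
    (n : nat) (hn : (3 <= n)%N)
    (D : finGroupType) (h0 h1 : D) (hD : dihedral_presentation n h0 h1)
    (phi : {morphism [set: D] >-> autF2 n.-1})
    (hphi : dihedral_rep h0 h1 phi) :
  let G := [set: semidirect phi]%G in
  let rho := rho_gens h0 h1 phi in
  let le := @coset_le (semidirect phi) 3 G rho in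
  let rk := @coset_rank (semidirect phi) 3 G rho in
  string_C_group G rho /\
  string_type rho = [:: n; n] /\
  regular_polytope le rk 3 /\
  corresponds_to le rk G rho /\
  schlafli_type le rk 3 [:: n; n].
Proof.
move=> G rho le rk; case: hD => _ genD rot_n h0_2 h1_2.
have CG : string_C_group G rho by apply: string_C_group_rho.
have typeE : string_type rho = [:: n; n].
  rewrite /string_type /= (order_rho01 hn rot_n hphi).
  by rewrite (order_rho12 hn rot_n h0_2 h1_2 hphi).
have [sG iG] := CG; split=> //; split=> //; split; first exact: coset_regular.
by rewrite -typeE; split; [apply: coset_corresponds | apply: coset_schlafli].
Qed.
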